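(* Let $k=\mathbb{F}_2$. If the order of the finite group $G$ equals an odd multiple of $2^i$ with $i\ge1$, then the operation $Q_n:\hat H^{-1}(G)\to\hat H^{-1-n}(G)$ is non-trivial whenever $n\ge 1$ is divisible by $2^i$.
   Context: $\hat H^*(G)=\hat H^*(G;k)$ is Tate cohomology. Operations $Q_s$ on $\hat H^*(G)$ for $p=2$: let $P$ be a complete projective resolution of $k$ by finitely generated right $kG$-modules: an exact complex $\cdots\leftarrow P_{-1}\leftarrow P_0\leftarrow P_1\leftarrow\cdots$ of projectives with $\varepsilon:P_0\to k$ a cokernel of $P_1\to P_0$. Put $(P^{\boxtimes2})_n=\prod_{s+t=n}P_s\otimes P_t$ with the tensor differential, diagonal action, and $\Sigma_2$ acting by the twist. For complexes $X,Y$ of $kG$-modules, $\mathrm{Hom}^n(X,Y)=\prod_j\mathrm{Hom}_{kG}(X_{n+j},Y_j)$ with $df=\partial f+f\partial$; $\hat H^*(G)=H^*\mathrm{Hom}^*(P,k)$. Let $\mathcal C(2)\subseteq\mathrm{Hom}^*(P,P^{\boxtimes2})$ be the subcomplex which is $0$ in positive degrees, consists of the cocycles in degree $0$, and in degrees $m<0$ consists of all $f$ whose components $P_i\to P_s\otimes P_t$ vanish whenever $i<0$ and $s,t\ge0$; it is augmented over $k$ by $f\mapsto c$ where $\varepsilon^{\boxtimes2}f=c\,\varepsilon$ (a quasi-isomorphism). Let $W$ be the standard free resolution of $k$ over $k\Sigma_2$ with one generator $e_i$ in each homological degree $i\ge0$ (cochain degree $-i$) and $de_i=(1+\tau)e_{i-1}$,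 and choose a $\Sigma_2$-equivariant chain map $\vartheta:W\to\mathcal C(2)$ over $\mathrm{id}_k$. For $x$ represented by a cocycle $a$, $Q_s(x)\in\hat H^{|x|-s}(G)$ is the class of $(a\boxtimes a)\circ\vartheta(e_{s+|x|})$ if $s+|x|\ge0$, and $Q_s(x)=0$ otherwise. *)

(* Defs.v *)
(* *t below is the tensor (Kronecker) product of real_closed.mxtens. *)
From HB Require Import structures.
From mathcomp Require Import all_boot all_order all_algebra all_fingroup.
From mathcomp Require Import all_character.
From mathcomp Require Import generic_quotient ring_quotient.
From mathcomp.real_closed Require Import mxtens.

Set Implicit Arguments.
Unset Strict Implicit.
Unset Printing Implicit Defensive.

Import Order.TTheory GRing.Theory Num.Theory.
Local Open Scope ring_scope.
Local Open Scope quotient_scope.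

(* The ground field is k = 'F_2 throughout, so no signs appear.
   A finitely generated right kG-module is a matrix representation of G, acting
   on row vectors by v |-> v *m rG g; a linear map with matrix f sends v to
   v *m f, so that "f followed by h" is f *m h. *)
Section Modules.

Variables (gT : finGroupType) (G : {group gT}).
Local Notation k := 'F_2.
Local Notation kGmod := (mx_representation k G).

Definition kG_hom m n (rM : kGmod m) (rN : kGmod n) (f : 'M[k]_(m, n)) : bool :=
  [forall g in G, rM g *m f == f *m rN g].

(* Lifting against surjections of finitely generated modules: as P is finitely
   generated, a free cover of P of finite rank is among the test maps. *)
Definition projective_mod n (rP : kGmod n) : Prop :=
  forall m1 m2 (rM : kGmod m1) (rN : kGmod m2)
         (q : 'M[k]_(m1, m2)) (f : 'M[k]_(n, m2)),
    kG_hom rM rN q -> row_full q -> kG_hom rP rN f ->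
  exists2 h : 'M[k]_(n, m1), kG_hom rP rM h & h *m q = f.

Lemma triv_mx_repr : mx_repr G (fun _ : gT => 1%:M : 'M[k]_1).
Proof. by split=> // x y _ _; rewrite mulmx1. Qed.
Definition triv_repr : kGmod 1 := MxRepresentation triv_mx_repr.

Lemma tens1mx1 m n : (1%:M : 'M[k]_m) *t (1%:M : 'M[k]_n) = 1%:M.
Proof.
apply/matrixP=> i j; case: (mxtens_indexP i)=> i0 i1.
case: (mxtens_indexP j)=> j0 j1; rewrite tensmxE !mxE.
rewrite (can_eq (@mxtens_indexK m n)) xpair_eqE.
by case: (i0 == j0); case: (i1 == j1); rewrite ?mulr1 ?mulr0 ?mul0r.
Qed.

Lemma tens_mx_repr m n (rM : kGmod m) (rN : kGmod n) :
  mx_repr G (fun g => rM g *t rN g).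
Proof.
split=> [|x y Gx Gy]; first by rewrite !repr_mx1 tens1mx1.
by rewrite !repr_mxM // tensmx_mul.
Qed.
(* Diagonal action on the tensor product. *)
Definition tens_repr m n (rM : kGmod m) (rN : kGmod n) : kGmod (m * n) :=
  MxRepresentation (tens_mx_repr rM rN).

(* M (x) N -> N (x) M, x (x) y |-> y (x) x. *)
Definition twist_mx m n : 'M[k]_(m * n, n * m) :=
  \matrix_(i, j) (mxtens_unindex i == ((mxtens_unindex j).2, (mxtens_unindex j).1))%:R.

(* cr_diff i j is the component P_i -> P_j of the differential, nonzero only for
   i = j + 1; indexing by both ends avoids casts along equalities in int. *)
Record complete_resolution := CompleteResolution {
  cr_dim : int -> nat;
  cr_mod : forall i, kGmod (cr_dim i);
  cr_diff : forall i j, 'M[k]_(cr_dim i, cr_dim j);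
  cr_aug : 'cV[k]_(cr_dim 0);
  cr_projective : forall i, projective_mod (cr_mod i);
  cr_diff_deg : forall i j, i != j + 1 -> cr_diff i j = 0;
  cr_diff_hom : forall i j, kG_hom (cr_mod i) (cr_mod j) (cr_diff i j);
  cr_exact : forall i, (cr_diff (i + 1) i == kermx (cr_diff i (i - 1)))%MS;
  cr_aug_hom : kG_hom (cr_mod 0) triv_repr cr_aug;
  cr_aug_onto : row_full cr_aug;
  cr_aug_ker : (cr_diff 1 0 == kermx cr_aug)%MS
}.

Section Resolution.

Variable P : complete_resolution.
Local Notation d := (cr_dim P).
Local Notation D := (cr_diff P).

(* Tate cohomology, as the cohomology of Hom^*(P, k) = Hom_kG(P_*, k). *)

Definition coch n (a : 'cV[k]_(d n)) : bool := kG_hom (cr_mod P n) triv_repr a.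

Definition is_cocycle n : pred 'cV[k]_(d n) :=
  fun a => coch a && (D (n + 1) n *m a == 0).

Lemma coch_zmod n : zmod_closed (@coch n).
Proof.
split=> [|a b Ha Hb]; first by apply/forall_inP=> g _; rewrite mulmx0 mul0mx.
apply/forall_inP=> g Gg; rewrite mulmxBr mulmxBl.
by rewrite (eqP (forall_inP Ha g Gg)) (eqP (forall_inP Hb g Gg)).
Qed.

Lemma is_cocycle_zmod n : zmod_closed (@is_cocycle n).
Proof.
have [c0 cB] := coch_zmod n.
split=> [|a b]; first by apply/andP; split=> //; rewrite mulmx0.
move=> /andP[Ha /eqP Da] /andP[Hb /eqP Db]; apply/andP; split; first exact: cB.
by rewrite mulmxBr Da Db subr0.
Qed.

HB.instance Definition _ n :=
  GRing.isZmodClosed.Build _ (@is_cocycle n) (is_cocycle_zmod n).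

Record cocycle n := Cocycle { cocycle_val :> 'cV[k]_(d n); _ : is_cocycle cocycle_val }.
HB.instance Definition _ n := [isSub for @cocycle_val n].
HB.instance Definition _ n := [Choice of cocycle n by <:].
HB.instance Definition _ n := [SubChoice_isSubZmodule of cocycle n by <:].

Definition is_coboundary n (a : cocycle n) : bool :=
  [exists b : 'cV[k]_(d (n - 1)), coch b && (val a == D n (n - 1) *m b)].

Lemma is_coboundary_zmod n : zmod_closed (@is_coboundary n).
Proof.
have [c0 cB] := coch_zmod (n - 1).
split=> [|a b].
  by apply/existsP; exists 0; rewrite mulmx0 raddf0 eqxx andbT.
move=> /existsP[a' /andP[Ha /eqP Ea]] /existsP[b' /andP[Hb /eqP Eb]].
apply/existsP; exists (a' - b'); rewrite mulmxBr raddfB /= Ea Eb eqxx andbT.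
exact: cB.
Qed.

HB.instance Definition _ n :=
  GRing.isZmodClosed.Build _ (@is_coboundary n) (is_coboundary_zmod n).

Definition coboundaries n : zmodClosed (cocycle n) :=
  GRing.ZmodClosed.clone (cocycle n) (@is_coboundary n) _.

Definition tate n := {ideal_quot (coboundaries n)}.
HB.instance Definition _ n := GRing.Zmodule.on (tate n).

Definition tate_class n (a : cocycle n) : tate n := \pi_(tate n) a.

(* A graded map P -> P^[x]2.  As (P^[x]2)_j is the product of the P_s (x) P_t
   over s + t = j, it is given by its components P_i -> P_s (x) P_t; those of a
   map of cohomological degree m are nonzero only for i = m + s + t. *)
Definition map2 := forall i s t : int, 'M[k]_(d i, d s * d t).

Definition hom2 (m : int) (f : map2) : Prop :=
  forall i s t,
    (i != m + (s + t) -> f i s t = 0) /\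
    kG_hom (cr_mod P i) (tens_repr (cr_mod P s) (cr_mod P t)) (f i s t).

Definition tens_diff2 (f : map2) : map2 := fun i s t =>
  f i (s + 1) t *m (D (s + 1) s *t 1%:M) + f i s (t + 1) *m (1%:M *t D (t + 1) t).

(* d f = (differential of P^[x]2) o f + f o (differential of P). *)
Definition hom2_diff (f : map2) : map2 := fun i s t =>
  tens_diff2 f i s t + D i (i - 1) *m f (i - 1) s t.

Definition twist2 (f : map2) : map2 := fun i s t =>
  f i t s *m twist_mx (d t) (d s).

Definition C2 (m : int) (f : map2) : Prop :=
  [/\ hom2 m f,
      0 < m -> forall i s t, f i s t = 0,
      m = 0 -> forall i s t, hom2_diff f i s t = 0
    & m < 0 -> forall i s t, i < 0 -> 0 <= s -> 0 <= t -> f i s t = 0].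

Definition C2_aug (f : map2) (c : k) : Prop :=
  f 0 0 0 *m (cr_aug P *t cr_aug P) = c *: cr_aug P.

(* W_i = k Sigma_2 e_i for every i >= 0, where (x, y) stands for (x + y tau) e_i;
   W_diff is W_i -> W_{i-1} for every i >= 1. *)
Definition W : zmodType := (k * k)%type.
Definition W_gen : W := (1, 0).
Definition W_twist (w : W) : W := (w.2, w.1).
Definition W_diff (w : W) : W := w + W_twist w.
Definition W_aug (w : W) : k := w.1 + w.2.

(* Sigma_2-equivariant chain maps W -> C(2) over the identity of k; additivity is
   k-linearity as k = 'F_2, and theta 0 w is a cocycle by the degree 0 part of C2. *)
Record theta_map := ThetaMap {
  theta : nat -> W -> map2;
  theta_add : forall j u v i s t,
    theta j (u + v) i s t = theta j u i s t + theta j v i s t;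
  theta_C2 : forall j w, C2 (- j%:Z) (theta j w);
  theta_twist : forall j w i s t,
    theta j (W_twist w) i s t = twist2 (theta j w) i s t;
  theta_diff : forall j w i s t,
    hom2_diff (theta j.+1 w) i s t = theta j (W_diff w) i s t;
  theta_aug : forall w, C2_aug (theta 0 w) (W_aug w)
}.

(* (u [x] v) o f : P_i -> k, where u and v have degrees s and t. *)
Definition ev2 (f : map2) i s t (u : 'cV[k]_(d s)) (v : 'cV[k]_(d t)) : 'cV[k]_(d i) :=
  f i s t *m (u *t v).

Section Operations.

Variable th : theta_map.
Local Notation e j := (theta th j W_gen).

Lemma addF2 (V : lmodType k) (x : V) : x + x = 0.
Proof. by rewrite -mulr2n -scaler_nat (_ : 2%:R = 0) ?scale0r //; apply/val_inj. Qed.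

Lemma twist_tens m n (u : 'cV[k]_m) (v : 'cV[k]_n) :
  twist_mx n m *m (u *t v) = v *t u :> 'cV[k]_(n * m).
Proof.
apply/matrixP=> x y; case: (mxtens_indexP x) => x1 x2.
rewrite mxE (bigD1 (mxtens_index (x2, x1))) //= big1 ?addr0.
  rewrite !mxE !mxtens_indexK eqxx mul1r mulrC.
  by rewrite /= [X in _ X * _ _ _]ord1 [X in _ * _ _ X]ord1 [X in _ = _ X * _ _ _]ord1 [X in _ = _ * _ _ X]ord1.
move=> z; case: (mxtens_indexP z) => z1 z2.
rewrite (can_eq (@mxtens_indexK _ _)) xpair_eqE => nz.
by rewrite !mxE !mxtens_indexK xpair_eqE /= eq_sym [x2 == _]eq_sym andbC (negPf nz) mul0r.
Qed.

Lemma tens_mul_cV m n p q (A : 'M[k]_(m, n)) (B : 'M[k]_(p, q))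
    (u : 'cV[k]_n) (v : 'cV[k]_q) :
  (A *t B) *m (u *t v) = (A *m u) *t (B *m v) :> 'cV[k]_(m * p).
Proof. exact: (@tensmx_mul _ m n p q 1 1). Qed.

Lemma ev2_diff f i i' s s' t t' (u : 'cV[k]_(d s)) (v : 'cV[k]_(d t)) :
    i' = i - 1 -> s' = s + 1 -> t' = t + 1 ->
  D i i' *m ev2 f i' u v =
  ev2 (hom2_diff f) i u v + (ev2 f i (D s' s *m u) v + ev2 f i u (D t' t *m v)).
Proof.
move=> -> -> ->; rewrite /ev2 /hom2_diff /tens_diff2 !mulmxDl -!mulmxA.
by rewrite !tens_mul_cV !mul1mx [_ + D _ _ *m _]addrC -addrA addF2 addr0.
Qed.

Lemma ev2_hom m f i s t (u : 'cV[k]_(d s)) (v : 'cV[k]_(d t)) :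
  hom2 m f -> coch u -> coch v -> coch (ev2 f i u v).
Proof.
move=> Hf Hu Hv; apply/forall_inP=> g Gg; rewrite /= mulmx1 /ev2 mulmxA.
rewrite (eqP (forall_inP (Hf i s t).2 g Gg)) -mulmxA tens_mul_cV.
have /eqP := forall_inP Hu g Gg; have /eqP := forall_inP Hv g Gg.
by rewrite /= !mulmx1 => -> ->.
Qed.

Lemma diff_coch n n' (b : 'cV[k]_(d n')) : coch b -> coch (D n n' *m b).
Proof.
move=> Hb; apply/forall_inP=> g Gg; have /eqP := forall_inP Hb g Gg.
rewrite /= !mulmx1 mulmxA (eqP (forall_inP (cr_diff_hom P n n') g Gg)) -mulmxA.
by move=> ->.
Qed.

Lemma ev2_diff_theta j i s t (u : 'cV[k]_(d s)) (v : 'cV[k]_(d t)) :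
  ev2 (hom2_diff (e j)) i u v =
  if j is l.+1 then ev2 (e l) i u v + ev2 (e l) i v u else 0.
Proof.
rewrite /ev2; case: j => [|l].
  by have [_ _ -> //] := theta_C2 th 0 W_gen; rewrite mul0mx.
rewrite theta_diff theta_add theta_twist mulmxDl; congr (_ + _).
by rewrite /twist2 -mulmxA twist_tens.
Qed.

Lemma ev2_0l f i s t (v : 'cV[k]_(d t)) : ev2 f i (0 : 'cV[k]_(d s)) v = 0.
Proof. by rewrite /ev2 tens0mx mulmx0. Qed.

Lemma ev2_0r f i s t (u : 'cV[k]_(d s)) : ev2 f i u (0 : 'cV[k]_(d t)) = 0.
Proof. by rewrite /ev2 tensmx0 mulmx0. Qed.

Lemma ev2Dl f i s t (u u' : 'cV[k]_(d s)) (v : 'cV[k]_(d t)) :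
  ev2 f i (u + u') v = ev2 f i u v + ev2 f i u' v.
Proof.
by rewrite /ev2 -mulmxDr; congr (_ *m _); apply/matrixP=> x y; rewrite !mxE mulrDl.
Qed.

Lemma ev2Dr f i s t (u : 'cV[k]_(d s)) (v v' : 'cV[k]_(d t)) :
  ev2 f i u (v + v') = ev2 f i u v + ev2 f i u v'.
Proof.
by rewrite /ev2 -mulmxDr; congr (_ *m _); apply/matrixP=> x y; rewrite !mxE mulrDr.
Qed.

(* The representative (a [x] a) o theta(e_j) of the value on the class of a. *)
Lemma ev2_cocycle j i m (a : cocycle m) : is_cocycle (ev2 (e j) i a a).
Proof.
case: a => a /= /andP[Ha /eqP Da]; apply/andP; split.
  by have [He _ _ _] := theta_C2 th j W_gen; exact: (ev2_hom i He Ha Ha).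
rewrite (@ev2_diff _ _ i _ (m + 1) _ (m + 1)) ?addrK // Da ev2_diff_theta.
rewrite ev2_0l ev2_0r !addr0.
by case: j => // l; rewrite addF2.
Qed.

Definition Q_rep j i m (a : cocycle m) : cocycle i :=
  Cocycle (ev2_cocycle j i a).

Definition tate_Q (s m : int) (x : tate m) : tate (m - s) :=
  if s + m is Posz j then tate_class (Q_rep j (m - s) (repr x)) else 0.

Lemma Q_rep_coboundary j i m (a a' : cocycle m) :
  is_coboundary (a' - a) -> is_coboundary (Q_rep j i a' - Q_rep j i a).
Proof.
case: a a' => [a Ca] [a' Ca'] /existsP[b /andP[Hb /eqP]].
rewrite raddfB /= => /(canRL (subrK _)) Ea'.
have /andP[Ha /eqP Da] := Ca; rewrite /is_coboundary.
set db := D m (m - 1) *m b in Ea'.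
have Hdb : coch db by apply: diff_coch.
have Ddb : D (m + 1) m *m db = 0.
  have /andP[_ /eqP] := Ca'; rewrite Ea' mulmxDr Da addr0 //.
have [He _ _ _] := theta_C2 th j W_gen.
pose w1 := ev2 (e j) (i - 1) b a + ev2 (e j) (i - 1) a b + ev2 (e j) (i - 1) b db.
pose w := w1 + (if j is l.+1 then ev2 (e l) (i - 1) b b else 0).
have chD n (x y : 'cV[k]_(d n)) : coch x -> coch y -> coch (x + y).
  move=> Hx Hy; apply/forall_inP=> g Gg; rewrite mulmxDr mulmxDl.
  by rewrite (eqP (forall_inP Hx g Gg)) (eqP (forall_inP Hy g Gg)).
apply/existsP; exists w; apply/andP; split.
  apply: (chD).
    by apply: (chD); [apply: (chD)|]; apply: (ev2_hom _ He).
  case: j {He w w1} => [|l]; first exact: (coch_zmod _).1.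
  by have [He _ _ _] := theta_C2 th l W_gen; exact: (ev2_hom _ He Hb Hb).
have m1 : m = m - 1 + 1 by rewrite subrK.
apply/eqP; rewrite raddfB /= Ea' /w /w1 !mulmxDr.
rewrite (@ev2_diff _ _ _ _ m _ (m + 1)) // (@ev2_diff _ _ _ _ (m + 1) _ m) //.
rewrite (@ev2_diff _ _ _ _ m _ (m + 1)) // -/db Da Ddb.
rewrite ev2_0l !ev2_0r !addr0 !ev2_diff_theta !ev2Dl !ev2Dr.
rewrite addrA addrK -addrA addrC.
case: j {He w w1} => [|l]; first by rewrite mulmx0 !add0r !addr0.
rewrite (@ev2_diff _ _ _ _ m _ m) // -/db ev2_diff_theta.
set X := (if l is _.+1 then _ else _); have -> : X = 0.
  by rewrite /X; case: (l) => // l'; rewrite addF2.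
rewrite add0r [ev2 _ _ a b + _]addrC [ev2 (e l) i db b + _]addrC.
set U := ev2 _ _ b a + _; set V := ev2 _ _ b db + _; rewrite add0r.
by rewrite [U + _ + _]addrACA addF2 add0r [V + _]addrC -[RHS]addrA -[_ + V + V]addrA addF2 addr0.
Qed.

(* tate_Q does not depend on the representing cocycle. *)
Lemma tate_Q_class (s m : int) (a : cocycle m) :
  tate_Q s (tate_class a) =
  if s + m is Posz j then tate_class (Q_rep j (m - s) a) else 0.
Proof.
rewrite /tate_Q; case: (s + m) => // j; apply/eqmodP.
rewrite /= /Quotient.equiv; apply: Q_rep_coboundary.
have : \pi_(tate m) (repr (tate_class a)) = \pi_(tate m) a by rewrite reprK.
by move/eqmodP.
Qed.

End Operations.
End Resolution.
End Modules.

(* Main.v *)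
(* Write the augmented resolution as D_0 = eps followed by eta, choose a linear form c
   on P_{-1} with c o D_0 = eps, and let x be the class of the trace of c over G.  For a
   Sylow 2-subgroup S one may arrange that this is also a trace over S.  Evaluated on a
   trace zeta = Tr_S(w) that is a cycle of degree -1 - n, the cocycle representing Q_n(x)
   becomes the sum over r in S of (c (x) r c) theta(e_{n-1})(zeta).  The terms of r and
   r^-1 agree, and the term of r with r^2 = 1 is, up to a constant independent of r, the
   restriction to <r> of the class of zeta in H^n(S), read off by descending along
   zeta = xi D |-> xi (1 + r).

   It remains to find zeta whose restriction is 1 for a single r.  Let z be a central
   involution of S.  The tensor power, over the cosets of <z>, of the standard free
   resolution of Z/2 is a contractible S-complex carrying an invariant cocycle of every
   degree divisible by the number of cosets, namely a power of the Euler class of the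
   representation induced from the sign of <z>.  It restricts non-trivially to <z>, whereas
   every other r fixes a vertex.  Comparing the complex with P_{-1} -> P_{-2} -> ...,
   which is relatively injective by Higman's criterion, turns the cocycle into zeta. *)
Require Import Defs.
From mathcomp Require Import all_boot all_order all_algebra all_fingroup.
From mathcomp Require Import all_solvable all_character.
From mathcomp Require Import generic_quotient ring_quotient.
From mathcomp.real_closed Require Import mxtens.

Set Implicit Arguments.
Unset Strict Implicit.
Unset Printing Implicit Defensive.

Import Order.TTheory GRing.Theory Num.Theory.
Local Open Scope ring_scope.

Lemma addF2_eq0 (V : lmodType 'F_2) (x y : V) : x + y = 0 -> x = y.
Proof. by move=> e; rewrite -[LHS]addr0 -(addF2 y) addrA e add0r. Qed.

(** * The tensor power of the standard resolution *)

Section ProductResolution.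

Variable B : finType.

(* Basis elements of the tensor power over B of the resolution W of Z/2: the cell (m, x)
   is the tensor product of the generators x b in degree m b.  Functions on cells are
   cochains, and [codiff] is the dual of d (m, x) = sum_b (m - 1_b, x) + (m - 1_b, x + 1_b),
   the sum being over the b with m b > 0. *)
Definition cell : Type := ({ffun B -> nat} * {ffun B -> bool})%type.

Definition lower (b : B) (m : {ffun B -> nat}) : {ffun B -> nat} :=
  [ffun b' => (m b' - (b' == b))%N].
Definition raise (b : B) (m : {ffun B -> nat}) : {ffun B -> nat} :=
  [ffun b' => (m b' + (b' == b))%N].
Definition flip (b : B) (x : {ffun B -> bool}) : {ffun B -> bool} :=
  [ffun b' => x b' (+) (b' == b)].

Lemma flipK b : involutive (flip b).
Proof. by move=> x; apply/ffunP=> b'; rewrite !ffunE -addbA addbb addbF. Qed.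

Lemma flipC b b' x : flip b (flip b' x) = flip b' (flip b x).
Proof. by apply/ffunP=> a; rewrite !ffunE addbAC. Qed.

Lemma flip_same b x : flip b x b = ~~ x b.
Proof. by rewrite ffunE eqxx addbT. Qed.

Lemma flip_other b b' x : b' != b -> flip b x b' = x b'.
Proof. by rewrite ffunE => /negPf->; rewrite addbF. Qed.

Lemma raiseK b : cancel (raise b) (lower b).
Proof. by move=> m; apply/ffunP=> b'; rewrite !ffunE addnK. Qed.

Lemma lowerK b (m : {ffun B -> nat}) : (0 < m b)%N -> raise b (lower b m) = m.
Proof.
move=> mb; apply/ffunP=> b'; rewrite !ffunE; case: eqP => [->|_].
  by rewrite subnK.
by rewrite subn0 addn0.
Qed.

Lemma lower_raiseC b b' m : b' != b -> lower b' (raise b m) = raise b (lower b' m).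
Proof.
move=> nb; apply/ffunP=> a; rewrite !ffunE; case: (eqVneq a b) => [->|_].
  by rewrite eq_sym (negPf nb) !subn0.
by rewrite !addn0.
Qed.

Variable V : lmodType 'F_2.
Implicit Type f g h : cell -> V.

Definition codiff_at b f (c : cell) : V :=
  if (0 < c.1 b)%N then f (lower b c.1, c.2) + f (lower b c.1, flip b c.2) else 0.

Definition codiff f (c : cell) : V := \sum_b codiff_at b f c.

(** [cone] and [base] dualize the contraction of the factor [b] onto its vertex [false]; the chain
    homotopy raises the degree in direction [b] of cells with [x b] true and clears that
    coordinate. *)
Definition cone b f (c : cell) : V :=
  if c.2 b then f (raise b c.1, flip b c.2) else 0.

Definition base b f (c : cell) : V :=
  if c.1 b == 0%N then f (c.1, if c.2 b then flip b c.2 else c.2) else 0.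

Lemma codiff_cone_same b f c :
  codiff_at b (cone b f) c + cone b (codiff_at b f) c = f c + base b f c.
Proof.
case: c => m x; rewrite /codiff_at /cone /base /= flip_same.
rewrite !ffunE eqxx addn1 /= raiseK flipK.
case: (posnP (m b)) => [_|mb] /=.
  by case: (x b); rewrite add0r ?addF2 // addrC.
rewrite lowerK //; case: (x b) => /=; last by rewrite !addr0 add0r.
by rewrite !addr0 addrA addF2 add0r.
Qed.

Lemma codiff_cone_other b b' f c : b' != b ->
  codiff_at b' (cone b f) c = cone b (codiff_at b' f) c.
Proof.
move=> nb; have nb' : b != b' by rewrite eq_sym.
case: c => m x; rewrite /codiff_at /cone /= flip_other // !ffunE (negPf nb) addn0.
case: ifP => _; last by case: ifP.
by case: ifP => _; [rewrite lower_raiseC // flipC | rewrite addr0].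
Qed.

Lemma codiff_base_same b f c : codiff_at b (base b f) c = 0.
Proof.
case: c => m x; rewrite /codiff_at /base /= flip_same flipK.
by case: ifP => // _; case: ifP => _; rewrite ?addr0 //; case: (x b); rewrite addF2.
Qed.

Lemma base_codiff_same b f c : base b (codiff_at b f) c = 0.
Proof. by case: c => m x; rewrite /codiff_at /base /=; case: eqP => // ->. Qed.

Lemma codiff_base_other b b' f c : b' != b ->
  codiff_at b' (base b f) c = base b (codiff_at b' f) c.
Proof.
move=> nb; have nb' : b != b' by rewrite eq_sym.
case: c => m x; rewrite /codiff_at /base /= flip_other // ffunE (negPf nb') subn0.
case: ifP => _; last by case: ifP; rewrite ?addr0.
by case: ifP => _; [case: (x b) => //; rewrite flipC | rewrite addr0].
Qed.

Lemma codiffD f g c : codiff (fun c => f c + g c) c = codiff f c + codiff g c.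
Proof.
rewrite /codiff -big_split; apply: eq_bigr => b _ /=.
by rewrite /codiff_at; case: ifP => _; rewrite ?addr0 // addrACA.
Qed.

Lemma sum_base b (I : finType) (P : pred I) (F : I -> cell -> V) c :
  \sum_(i | P i) base b (F i) c = base b (fun c => \sum_(i | P i) F i c) c.
Proof. by rewrite /base; case: (c.1 b == 0%N); rewrite // big1. Qed.

Lemma sum_cone b (I : finType) (P : pred I) (F : I -> cell -> V) c :
  \sum_(i | P i) cone b (F i) c = cone b (fun c => \sum_(i | P i) F i c) c.
Proof. by rewrite /cone; case: (c.2 b); rewrite // big1. Qed.

Definition codiff_closed f := forall c, codiff f c = 0.

Lemma closed_rest b f c : codiff_closed f ->
  \sum_(b' | b' != b) codiff_at b' f c = codiff_at b f c.
Proof.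
by move=> /(_ c); rewrite /codiff (bigD1 b) //= => /addF2_eq0/esym.
Qed.

Lemma closed_base b f : codiff_closed f -> codiff_closed (base b f).
Proof.
move=> cf c; rewrite /codiff (bigD1 b) //= codiff_base_same add0r.
under eq_bigr => b' nb do rewrite codiff_base_other //.
rewrite sum_base; apply: etrans (base_codiff_same b f c); rewrite /base.
by case: ifP => // _; apply: closed_rest.
Qed.

(** Closedness trades all directions other than [b] for direction [b], so the one-factor homotopy
    identity becomes global. *)
Lemma codiff_cone b f c : codiff_closed f -> codiff (cone b f) c = f c + base b f c.
Proof.
move=> cf; rewrite -codiff_cone_same /codiff (bigD1 b) //=; congr (_ + _).
under eq_bigr => b' nb do rewrite codiff_cone_other //.
rewrite sum_cone /cone; case: ifP => // _.
exact: closed_rest.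
Qed.

Definition cell_deg (c : cell) : nat := \sum_b c.1 b.

Definition homog n f := forall c, cell_deg c != n -> f c = 0.

Definition cell0 (x : {ffun B -> bool}) : cell := ([ffun => 0%N], x).

Lemma cell_deg_eq0 c : cell_deg c = 0%N -> c = cell0 c.2.
Proof.
case: c => m x /eqP; rewrite /cell_deg sum_nat_eq0 => /forallP m0.
by congr pair; apply/ffunP => b; rewrite ffunE; apply/eqP; exact: m0.
Qed.

(** A cell of degree 1 is an edge between vertices differing by one flip, and closedness equates
    their values. *)
Lemma closed_const f x y : codiff_closed f -> f (cell0 x) = f (cell0 y).
Proof.
move=> cf; have fl b z : f (cell0 (flip b z)) = f (cell0 z).
  have := cf (raise b [ffun => 0%N], z).
  rewrite /codiff (bigD1 b) //= big1 => [|b' nb].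
    rewrite /codiff_at /= !ffunE eqxx /= raiseK addr0.
    by move/addF2_eq0/esym.
  by rewrite /codiff_at /= !ffunE (negPf nb).
have to0 (s : seq B) (z : {ffun B -> bool}) :
    f (cell0 [ffun b => z b && (b \notin s)]) = f (cell0 z).
  elim: s => [|b s IH].
    by congr (f (cell0 _)); apply/ffunP=> b; rewrite ffunE andbT.
  rewrite -IH; case: (boolP (z b && (b \notin s))) => zb.
    rewrite -(fl b); congr (f (cell0 _)); apply/ffunP=> b'.
    rewrite !ffunE inE; case: (eqVneq b' b) => [->|_]; last by rewrite addbF.
    by rewrite zb andbF.
  congr (f (cell0 _)); apply/ffunP=> b'; rewrite !ffunE inE.
  by case: eqP => // ->; rewrite (negPf zb) andbF.
rewrite -(to0 (enum B) x) -(to0 (enum B) y); congr (f (cell0 _)).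
by apply/ffunP=> b; rewrite !ffunE mem_enum !andbF.
Qed.

Lemma cell_deg_lower b (m : {ffun B -> nat}) x : (0 < m b)%N ->
  cell_deg (m, x) = (cell_deg (lower b m, x)).+1.
Proof.
move=> mb; rewrite /cell_deg (bigD1 b) //= [in RHS](bigD1 b) //= ffunE eqxx.
rewrite -addSn -subSn // subn1 /=; congr (_ + _)%N.
by apply: eq_bigr => b' /negPf nb; rewrite ffunE nb subn0.
Qed.

Lemma codiff_trunc n h c :
  codiff (fun c => if cell_deg c == n then h c else 0) c =
  if cell_deg c == n.+1 then codiff h c else 0.
Proof.
rewrite /codiff; case: c => m x.
case: ifP => e; [apply: eq_bigr => b _ | apply: big1 => b _]; rewrite /codiff_at /=.
  case: ifP => // mb; move: e.
  by rewrite (cell_deg_lower x mb) eqSS /cell_deg /= => ->.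
case: ifP => // mb; move: e.
by rewrite (cell_deg_lower x mb) eqSS /cell_deg /= => ->; rewrite addr0.
Qed.

(** Contracting the factors one after another leaves a cochain supported on vertices, where it
    vanishes; truncation makes the primitive homogeneous. *)
Lemma acyclic n g : homog n.+1 g -> codiff_closed g ->
  exists2 h, homog n h & codiff h =1 g.
Proof.
move=> hg cg; have g0 x : g (cell0 x) = 0.
  by apply: hg; rewrite /cell_deg big1 // => b _; rewrite ffunE.
suff [h eh] : exists h, codiff h =1 g.
  exists (fun c => if cell_deg c == n then h c else 0) => c.
    by move/negPf->.
  by rewrite codiff_trunc eh; case: eqP => // /eqP/hg.
suff [h [g' [eg _ s0 g'0]]] : exists h g', [/\ forall c, g c = g' c + codiff h c,
    codiff_closed g', (forall (c : cell) b, b \in enum B -> c.1 b != 0%N -> g' c = 0)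
    & forall x, g' (cell0 x) = 0].
  exists h => c; rewrite eg; suff ->: g' c = 0 by rewrite add0r.
  case: (boolP [exists b, c.1 b != 0%N]) => [/existsP[b]|/existsPn nz].
    by apply: s0; rewrite mem_enum.
  rewrite [c]cell_deg_eq0 // /cell_deg big1 // => b _.
  by apply/eqP; have := nz b; rewrite negbK.
elim: (enum B) => [|b s [h [g' [eg cg' s0 g'0]]]].
  exists (fun=> 0), g; split=> // c.
  by rewrite /codiff big1 ?addr0 // => b _; rewrite /codiff_at addr0 if_same.
exists (fun c => h c + cone b g' c), (base b g'); split.
- move=> c; rewrite codiffD codiff_cone // eg [base _ _ _ + _]addrC.
  by rewrite -!addrA addF2 addr0 addrC.
- exact: closed_base.
- move=> c b'; rewrite inE /base => b's nz; case: eqP => // cb.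
  case/predU1P: b's nz => [->|b's nz]; first by rewrite cb.
  by apply: s0 b's _.
by move=> x; rewrite /base /= ffunE eqxx /=; apply: g'0.
Qed.

Lemma codiff_sum (I : finType) (P : pred I) (F : I -> cell -> V) c :
  codiff (fun c => \sum_(i | P i) F i c) c = \sum_(i | P i) codiff (F i) c.
Proof.
rewrite /codiff exchange_big /=; apply: eq_bigr => b _; rewrite /codiff_at.
by case: ifP => _; rewrite -?big_split // big1.
Qed.

(** This represents the monomial with exponents [mu] in the polynomial cohomology of (Z/2)^B, with
    coefficient [v]. *)
Definition mono_cochain (v : V) (mu : {ffun B -> nat}) (c : cell) : V :=
  if c.1 == mu then v else 0.

(** Keeping only the half [x b = true] lets exactly one of the two terms in direction [b] survive in
    the codifferential. *)
Definition mono_primitive (v : V) (b : B) (mu : {ffun B -> nat}) (c : cell) : V :=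
  if (c.1 == lower b mu) && c.2 b then v else 0.

Lemma codiff_mono_primitive v b (mu : {ffun B -> nat}) : (0 < mu b)%N ->
  codiff (mono_primitive v b mu) =1 mono_cochain v mu.
Proof.
move=> mub [m x]; rewrite /codiff (bigD1 b) //= big1 => [|b' nb].
  rewrite addr0 /codiff_at /mono_primitive /mono_cochain /= flip_same.
  case: posnP => mb; first by case: eqP mub => // <-; rewrite mb.
  rewrite -[in RHS](lowerK mb) -[in RHS](lowerK mub) (can_eq (@raiseK b)).
  by case: eqP => _; case: (x b); rewrite ?addr0 ?add0r.
rewrite /codiff_at /mono_primitive /= flip_other 1?eq_sym //.
by case: ifP => // _; rewrite addF2.
Qed.

Lemma homog_mono_cochain v (mu : {ffun B -> nat}) : homog (\sum_b mu b) (mono_cochain v mu).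
Proof.
by move=> [m x]; rewrite /mono_cochain /cell_deg /=; case: (m =P mu) => // ->; rewrite eqxx.
Qed.

Lemma closed_mono_cochain v mu : codiff_closed (mono_cochain v mu).
Proof.
move=> [m x]; rewrite /codiff big1 // => b _.
by rewrite /codiff_at /mono_cochain /= addF2 if_same.
Qed.

Lemma homog_mono_primitive v b (mu : {ffun B -> nat}) n : (0 < mu b)%N ->
  (\sum_b mu b = n.+1)%N -> homog n (mono_primitive v b mu).
Proof.
move=> mub emu [m x]; rewrite /mono_primitive /=; case: (m =P _) => //= ->.
by have := cell_deg_lower x mub; rewrite {1}/cell_deg /= emu => -[<-]; rewrite eqxx.
Qed.

(** * Signed permutations of the tensor factors *)

Section SignedPermutation.

Variables (p : B -> B) (s : B -> bool).
Hypothesis p_inj : injective p.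

(** Precomposition turns a left action on [B] into a right action on cells, matching the right
    modules P_i. *)
Definition sperm (c : cell) : cell :=
  ([ffun b => c.1 (p b)], [ffun b => c.2 (p b) (+) s b]).

Lemma codiff_sperm f c : codiff (fun c => f (sperm c)) c = codiff f (sperm c).
Proof.
case: c => m x; rewrite /codiff (reindex_inj p_inj) /=; apply: eq_bigr => b _.
rewrite /codiff_at /sperm /= ffunE; case: ifP => // _; congr (f _ + f _).
  by congr pair; apply/ffunP=> b'; rewrite !ffunE inj_eq.
by congr pair; apply/ffunP=> b'; rewrite !ffunE inj_eq // addbAC.
Qed.

Lemma cell_deg_sperm c : cell_deg (sperm c) = cell_deg c.
Proof.
rewrite [RHS]/cell_deg (reindex_inj p_inj) /=.
by apply: eq_bigr => b _; rewrite ffunE.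
Qed.

Lemma sperm_cell0 x : sperm (cell0 x) = cell0 (sperm (cell0 x)).2.
Proof. by congr pair; apply/ffunP=> b; rewrite !ffunE. Qed.

End SignedPermutation.

End ProductResolution.

Lemma codiff_mulmx (B : finType) m n (M : 'M['F_2]_(m, n)) (h : cell B -> 'rV_m) c :
  codiff (fun c => h c *m M) c = codiff h c *m M.
Proof.
rewrite /codiff mulmx_suml; apply: eq_bigr => b _; rewrite /codiff_at.
by case: ifP => _; rewrite ?mul0mx // mulmxDl.
Qed.

(** * Values of the operations on chains *)

Section Evaluation.

Variables (gT : finGroupType) (G : {group gT}) (P : complete_resolution G).
Local Notation k := 'F_2.
Local Notation d := (cr_dim P).
Local Notation D := (cr_diff P).
Local Notation rho := (cr_mod P).
Local Notation eps := (cr_aug P).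

Lemma kG_homE m n (rM : mx_representation k G m) (rN : mx_representation k G n) f g :
  kG_hom rM rN f -> g \in G -> rM g *m f = f *m rN g.
Proof. by move=> hf Gg; apply/eqP; exact: (forall_inP hf). Qed.

Lemma rho_diff g i j : g \in G -> rho i g *m D i j = D i j *m rho j g.
Proof. exact: kG_homE (cr_diff_hom P i j). Qed.

Lemma rho_aug g : g \in G -> rho 0 g *m eps = eps.
Proof. by move=> Gg; rewrite (kG_homE (cr_aug_hom P) Gg) /= mulmx1. Qed.

Lemma diff_aug : D 1 0 *m eps = 0.
Proof. by apply/sub_kermxP; have /andP[] := cr_aug_ker P. Qed.

Lemma diff_diff i : D (i + 1) i *m D i (i - 1) = 0.
Proof. by apply/sub_kermxP; have /andP[] := cr_exact P i. Qed.

Lemma ev2_act m f i s t (u : 'cV_(d s)) (v : 'cV_(d t)) g : hom2 m f -> g \in G ->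
  rho i g *m ev2 f i u v = ev2 f i (rho s g *m u) (rho t g *m v).
Proof.
move=> Hf Gg; rewrite /ev2 mulmxA (kG_homE (Hf i s t).2 Gg) -mulmxA.
by rewrite tens_mul_cV.
Qed.

Variable th : theta_map P.
Local Notation e j := (theta th j W_gen).

Lemma theta_hom2 j : hom2 (- j%:Z) (e j).
Proof. by case: (theta_C2 th j W_gen). Qed.

(** The vanishing condition in [C2] enters here; it starts at e_1 because it concerns negative
    degrees only. *)
Lemma ev2_theta_aug j i : i < 0 -> ev2 (e j.+1) i eps eps = 0.
Proof.
move=> i0; have [_ _ _ e0] := theta_C2 th j.+1 W_gen.
by rewrite /ev2 e0 ?mul0mx.
Qed.

Variable c : 'cV[k]_(d (-1)).
Hypothesis diff_c : D 0 (-1) *m c = eps.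

Lemma diff_rho_c g : g \in G -> D 0 (-1) *m (rho (-1) g *m c) = eps.
Proof. by move=> Gg; rewrite mulmxA -rho_diff // -mulmxA diff_c rho_aug. Qed.

Lemma diff_ev2_cc j i r : r \in G ->
  D i (i - 1) *m ev2 (e j) (i - 1) c (rho (-1) r *m c) =
  (if j is l.+1 then ev2 (e l) i c (rho (-1) r *m c) + ev2 (e l) i (rho (-1) r *m c) c
   else 0) + (ev2 (e j) i eps (rho (-1) r *m c) + ev2 (e j) i c eps).
Proof.
move=> Gr; rewrite (@ev2_diff _ _ _ _ i (i - 1) (-1) 0 (-1) 0 c _ erefl erefl erefl).
by rewrite ev2_diff_theta diff_c diff_rho_c.
Qed.

Lemma diff_ev2_augc j i : i < 0 ->
  D i (i - 1) *m ev2 (e j.+1) (i - 1) eps c = ev2 (e j) i eps c + ev2 (e j) i c eps.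
Proof.
move=> i0; rewrite (@ev2_diff _ _ _ _ i (i - 1) 0 1 (-1) 0) //.
by rewrite ev2_diff_theta diff_c diff_aug ev2_0l ev2_theta_aug // !addr0.
Qed.

(* Multiplied by an r-invariant cycle in degree i = -1 - n, this column gives the
   degree n component of the restriction to <[r]> of the corresponding class. *)
Definition res_col r n i : 'cV[k]_(d i) :=
  ev2 (e n) i eps c + (if n is l.+1 then ev2 (e l) i c (rho (-1) r *m c) else 0).

Lemma mul_res_colS r n i m (A : 'M[k]_(m, d i)) :
  A *m res_col r n.+1 i =
  A *m ev2 (e n.+1) i eps c + A *m ev2 (e n) i c (rho (-1) r *m c).
Proof. exact: mulmxDr. Qed.

(** Leibniz rule with [D c = eps]. Evaluated on xi, it gives the descent: xi D in degree n + 1 has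
    the same value as xi (1 + r) in degree n. *)
Lemma diff_res_col r n i : r \in G -> (r * r = 1)%g -> i < 0 ->
  D i (i - 1) *m res_col r n.+1 (i - 1) = res_col r n i + rho i r *m res_col r n i.
Proof.
move=> Gr rr i0; rewrite /res_col !mulmxDr diff_ev2_augc // diff_ev2_cc //.
rewrite (ev2_act _ _ _ (theta_hom2 n) Gr) rho_aug //.
have rrc : rho (-1) r *m (rho (-1) r *m c) = c.
  by rewrite mulmxA -repr_mxM // rr repr_mx1 mul1mx.
set a := ev2 _ _ eps c; set b := ev2 _ _ c eps; set a' := ev2 _ _ eps _.
case: n @a @b @a' => [|l] a b a'.
  by rewrite mulmx0 !addr0 add0r addrACA addF2 addr0.
rewrite (ev2_act _ _ _ (theta_hom2 l) Gr) rrc.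
set x := ev2 _ _ c _; set y := ev2 _ _ _ c.
by rewrite (AC (2*(2*2)) ((1*3)*(5*4)*(2*6))) /= addF2 addr0.
Qed.

(** The augmentation condition on [theta 0] anchors the descent. *)
Lemma diff_res_col0 r : D 0 (-1) *m res_col r 0 (-1) = eps.
Proof.
rewrite /res_col addr0 (@ev2_diff _ _ _ _ 0 (-1) 0 1 (-1) 0) //.
rewrite ev2_diff_theta diff_c diff_aug ev2_0l !add0r.
by have := theta_aug th W_gen; rewrite /C2_aug /W_aug /= addr0 scale1r.
Qed.

(* The terms differ by (eps (x) eps) theta(e_{l+2}) (zeta), which vanishes by the condition
   on negative indices in C(2). *)
Lemma ev2_inv_symm r l i (zeta : 'rV[k]_(d i)) : r \in G -> i < 0 ->
  zeta *m D i (i - 1) = 0 -> zeta *m rho i r = zeta ->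
  zeta *m ev2 (e l) i c (rho (-1) r *m c) = zeta *m ev2 (e l) i c (rho (-1) r^-1%g *m c).
Proof.
move=> Gr i0 zD zr.
have /(congr1 (mulmx zeta)) := diff_ev2_cc l.+1 i Gr.
have /(congr1 (mulmx zeta)) := diff_ev2_augc l.+1 i0.
rewrite ![zeta *m (D _ _ *m _)]mulmxA zD !mul0mx !mulmxDr => e1.
have -> : zeta *m ev2 (e l.+1) i eps (rho (-1) r *m c) = zeta *m ev2 (e l.+1) i eps c.
  rewrite -[in LHS](rho_aug Gr) -(ev2_act _ _ _ (theta_hom2 _) Gr).
  by rewrite [zeta *m (_ *m _)]mulmxA zr.
rewrite -e1 addr0 => /esym/addF2_eq0 e2; apply: etrans e2 _.
rewrite -[in RHS]zr -mulmxA (ev2_act _ _ _ (theta_hom2 _) Gr).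
have -> // : rho (-1) r *m (rho (-1) r^-1%g *m c) = c.
by rewrite mulmxA -repr_mxM ?groupV // mulgV repr_mx1 mul1mx.
Qed.

End Evaluation.

(** * Relative traces *)

(** [T] represents the right cosets of [S]. Quantifying [V] inside lets one [T] serve both module
    sums and the count of [T]. *)
Lemma transversal_sum (gT : finGroupType) (G S : {group gT}) : S \subset G ->
  exists2 T : {set gT}, T \subset G &
  forall (V : nmodType) (f : gT -> V),
    \sum_(x in G) f x = \sum_(t in T) \sum_(s in S) f (s * t)%g.
Proof.
move=> sSG; exists [set fingroup.repr (S :* x)%g | x in G].
  apply/subsetP=> _ /imsetP[x Gx ->].
  by apply: (subsetP (mul_subG sSG (_ : [set x] \subset G))); rewrite ?sub1set ?mem_repr_rcoset.
move=> V f; rewrite (partition_big_imset (fun x => fingroup.repr (S :* x)%g)) /=.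
apply: eq_bigr => _ /imsetP[x Gx ->]; set t := fingroup.repr _.
have tx : (S :* t = S :* x)%g by rewrite rcoset_repr.
have Gt : t \in G.
  by apply: (subsetP (mul_subG sSG (_ : [set x] \subset G))); rewrite ?sub1set ?mem_repr_rcoset.
rewrite (reindex_inj (mulIg t)); apply: eq_bigl => s /=.
apply/andP/idP => [[Gst /eqP est]|Ss].
  have : (s * t \in S :* (s * t))%g by rewrite rcoset_refl.
  by rewrite -(rcoset_repr S (s * t)) est tx -tx mem_rcoset mulgK.
split; first by rewrite groupM // (subsetP sSG).
by rewrite rcosetM rcoset_id // tx.
Qed.

Section RelativeTrace.

Variables (gT : finGroupType) (G : {group gT}).
Local Notation k := 'F_2.

(** The map u (x) id, contracting the first tensor factor. *)
Definition tens_col n d (u : 'cV[k]_n) : 'M[k]_(n * d, d) :=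
  \matrix_(i, j) (u (mxtens_unindex i).1 0 * ((mxtens_unindex i).2 == j)%:R).

Lemma mul_tens_col n n' d d' (A : 'M[k]_(n', n)) (X : 'M[k]_(d', d)) u :
  (A *t X) *m tens_col d u = tens_col d' (A *m u) *m X.
Proof.
apply/matrixP=> i j; case: (mxtens_indexP i) => i1 i2.
rewrite [LHS]mxE [RHS]mxE (reindex (@mxtens_index n d)) /=; last first.
  by exists (@mxtens_unindex n d) => ? _; rewrite (mxtens_indexK, mxtens_unindexK).
transitivity (\sum_a \sum_b (A *t X) (mxtens_index (i1, i2)) (mxtens_index (a, b)) *
    tens_col d u (mxtens_index (a, b)) j).
  by rewrite pair_bigA; apply: eq_bigr => -[a b] _.
rewrite [RHS](bigD1 i2) //= [X in _ = _ + X]big1 => [|b nb].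
  rewrite !mxE mxtens_indexK /= eqxx mulr1 addr0 big_distrl /=.
  apply: eq_bigr => a _; rewrite (bigD1 j) //= big1 => [|b nb].
    by rewrite tensmxE !mxE mxtens_indexK /= eqxx mulr1 addr0 mulrAC.
  by rewrite tensmxE !mxE mxtens_indexK /= (negPf nb) !mulr0.
by rewrite !mxE mxtens_indexK /= eq_sym (negPf nb) mulr0 mul0r.
Qed.

Lemma tens_col_sum n d (I : finType) (Q : pred I) (F : I -> 'cV[k]_n) :
  tens_col d (\sum_(i | Q i) F i) = \sum_(i | Q i) tens_col d (F i).
Proof.
apply/matrixP=> i j; rewrite !mxE !summxE big_distrl /=.
by apply: eq_bigr => a _; rewrite !mxE.
Qed.

Lemma tens_col1_full n d : (0 < n)%N -> row_full (tens_col d (const_mx 1 : 'cV[k]_n)).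
Proof.
case: n => // n _; apply/row_fullP.
exists (\matrix_(i, j) (mxtens_unindex j == (ord0, i))%:R).
apply/matrixP=> i j; rewrite mxE (bigD1 (mxtens_index (ord0, i))) //= big1.
  by rewrite !mxE mxtens_indexK eqxx !mul1r addr0.
move=> x; case: (mxtens_indexP x) => x1 x2; rewrite (can_eq (@mxtens_indexK _ _)) => nx.
by rewrite !mxE mxtens_indexK (negPf nx) mul0r.
Qed.

Definition regular_col (x : gT) : 'cV[k]_(#|G|) := \col_i (enum_val i == x)%:R.

Lemma regular_mul x : x \in G ->
  regular_mx k G x *m regular_col 1 = regular_col x^-1.
Proof.
move=> Gx; apply/colP=> i; rewrite !mxE (bigD1 (gring_index G 1)) //= big1 => [|j nj].
  rewrite !mxE !eqxx /= gring_indexK // eqxx mulr1 addr0.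
  rewrite -(inj_eq (can_inj (@gring_valK _ G))) /= !gring_indexK ?groupM ?enum_valP //.
  by rewrite eq_sym [in RHS]eq_mulgV1 invgK.
rewrite [X in _ * X]mxE (_ : enum_val j == 1%g = false) ?mulr0 //.
apply: contraNF nj => /eqP e; by rewrite -e gring_valK.
Qed.

Lemma sum_regular_col : \sum_(x in G) regular_col x = const_mx 1.
Proof.
apply/colP=> i; rewrite summxE mxE (bigD1 (enum_val i)) ?enum_valP //= big1 => [|x].
  by rewrite mxE eqxx addr0.
by case/andP=> _; rewrite mxE eq_sym => /negPf->.
Qed.

(* Higman's criterion: lift the identity along the free cover kG (x) M -> M. *)
Lemma projective_trace n (rM : mx_representation k G n) : projective_mod rM ->
  exists phi : 'M[k]_n, \sum_(x in G) rM x *m phi *m rM x^-1%g = 1%:M.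
Proof.
move=> pM; pose q := tens_col n (const_mx 1 : 'cV[k]_(#|G|)).
have R1 x : x \in G -> regular_mx k G x *m const_mx 1 = const_mx 1 :> 'cV_(#|G|).
  move=> Gx; apply/colP=> i; rewrite !mxE (bigD1 (gring_index G (enum_val i * x))) //=.
  rewrite big1 => [|j nj]; first by rewrite !mxE !eqxx mulr1 addr0.
  by rewrite !mxE eqxx (negPf nj) mul0r.
have [||| h hh hq] := pM _ _ (tens_repr (regular_repr k G) rM) rM q 1%:M.
- by apply/forall_inP=> x Gx; rewrite /= mul_tens_col R1.
- exact: tens_col1_full (cardG_gt0 G).
- by apply/forall_inP=> x Gx; rewrite mul1mx mulmx1.
(* Take the coefficient at 1 of the lift; its conjugates take the coefficients at all group
   elements, and these sum to [q]. *)
exists (h *m tens_col n (regular_col 1)).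
have e x : x \in G -> rM x *m (h *m tens_col n (regular_col 1)) *m rM x^-1%g =
    h *m tens_col n (regular_col x^-1).
  move=> Gx; rewrite mulmxA (kG_homE hh Gx) -[h *m _ *m _]mulmxA mul_tens_col.
  by rewrite regular_mul // -!mulmxA -repr_mxM ?groupV // mulgV repr_mx1 mulmx1.
rewrite (eq_bigr _ e) -mulmx_sumr -tens_col_sum (reindex_inj invg_inj) /=.
under eq_bigl do rewrite groupV.
by under eq_bigr do rewrite invgK; rewrite sum_regular_col.
Qed.

Lemma projective_relative_trace (S : {group gT}) n (rM : mx_representation k G n) :
    S \subset G -> projective_mod rM ->
  exists phi : 'M[k]_n, \sum_(x in S) rM x *m phi *m rM x^-1%g = 1%:M.
Proof.
move=> sSG /projective_trace[phi e]; have [T sTG sumT] := transversal_sum sSG.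
exists (\sum_(t in T) rM t *m phi *m rM t^-1%g).
rewrite -e sumT exchange_big /=; apply: eq_bigr => s Ss.
rewrite mulmx_sumr mulmx_suml; apply: eq_bigr => t Tt.
have Gs := subsetP sSG _ Ss; have Gt := subsetP sTG _ Tt.
by rewrite invMg !repr_mxM ?groupV // !mulmxA.
Qed.

End RelativeTrace.

(** * Comparison with the negative half of P *)

Section Towers.

Variables (gT : finGroupType) (G : {group gT}) (P : complete_resolution G).
Local Notation k := 'F_2.
Local Notation d := (cr_dim P).
Local Notation D := (cr_diff P).
Local Notation rho := (cr_mod P).

Variables (B : finType) (p : gT -> B -> B) (s : gT -> B -> bool).
Local Notation act g := (sperm (p g) (s g)).
Hypothesis p_inj : forall g, injective (p g).

Definition equiv_cochain (A : {set gT}) i (f : cell B -> 'rV[k]_(d i)) :=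
  forall g c, g \in A -> f (act g c) = f c *m rho i g.

Let origin : cell B := cell0 [ffun => false].

(* f : E_n -> P_i is carried to h D : E_(n-1) -> P_(i-1), where h is an A-equivariant
   solution of codiff h = f, down to E_0.  The predicate Q on the final value is passed as
   a continuation because that value lives in P_(i-n), whose index is not convertible. *)
Fixpoint tower (A : {set gT}) (n : nat) (i : int) :
    (cell B -> 'rV[k]_(d i)) -> (forall j, 'rV[k]_(d j) -> Prop) -> Prop :=
  match n with
  | 0 => fun f Q => Q i (f origin)
  | n'.+1 => fun f Q => exists h, [/\ homog n' h, equiv_cochain A h, codiff h =1 f
      & tower A n' (fun c => h c *m D i (i - 1)) Q]
  end.

Lemma eq_tower A n i (f g : cell B -> 'rV[k]_(d i)) Q :
  f =1 g -> tower A n f Q -> tower A n g Q.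
Proof.
case: n => [|n] e /=; first by rewrite e.
by case=> h [hh he hf ht]; exists h; split=> // c; rewrite hf.
Qed.

(** The chosen primitives stay valid for a smaller set, so one [zeta] built over [S] can be analysed
    for each [[set r]] separately. *)
Lemma tower_end A n i (f : cell B -> 'rV[k]_(d i)) Q : tower A n f Q ->
  exists j (zeta : 'rV[k]_(d j)), Q j zeta /\
    forall (A' : {set gT}) (Q' : forall j, 'rV[k]_(d j) -> Prop),
      A' \subset A -> Q' j zeta -> tower A' n f Q'.
Proof.
elim: n i f => [|n IH] i f /=; first by exists i, (f origin).
case=> h [hh he hf /IH[j [zeta [Qz tz]]]]; exists j, zeta; split=> // A' Q' sA' Qz'.
exists h; split=> //; last exact: tz.
by move=> g c gA; apply: he; apply: (subsetP sA').
Qed.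

Lemma diff_diff_pred i : D i (i - 1) *m D (i - 1) (i - 1 - 1) = 0.
Proof. by have := diff_diff P (i - 1); rewrite subrK. Qed.

Section Existence.

Variable S : {group gT}.
Hypothesis sSG : S \subset G.
Hypothesis p1 : forall b, p 1%g b = b.
Hypothesis s1 : forall b, s 1%g b = false.
Hypothesis pM : {in S &, forall g h b, p h (p g b) = p (h * g)%g b}.
Hypothesis sM : {in S &, forall g h b, s h (p g b) (+) s g b = s (h * g)%g b}.

Lemma sperm_act1 c : act 1%g c = c.
Proof.
by case: c => m x; congr pair; apply/ffunP=> b; rewrite !ffunE /= ?s1 p1 ?addbF.
Qed.

Lemma sperm_actM g h c : g \in S -> h \in S -> act g (act h c) = act (h * g)%g c.
Proof.
move=> Sg Sh; case: c => m x.
by congr pair; apply/ffunP=> b; rewrite !ffunE /= pM // -sM // addbA.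
Qed.

(* Average a solution of [codiff h = f] against a Higman trace of the identity. *)
Lemma equiv_acyclic n i (f : cell B -> 'rV[k]_(d i)) :
  homog n.+1 f -> codiff_closed f -> equiv_cochain S f ->
  exists h, [/\ homog n h, equiv_cochain S h & codiff h =1 f].
Proof.
move=> hf cf ef; have [h hh eh] := acyclic hf cf.
have [phi tr] := projective_relative_trace sSG (@cr_projective _ _ P i).
exists (fun c => \sum_(g in S) h (act g^-1%g c) *m (phi *m rho i g)); split.
- move=> c nc; rewrite big1 // => g _; rewrite hh ?mul0mx //.
  by rewrite cell_deg_sperm.
- move=> a c Sa; rewrite (reindex_inj (mulIg a)) /= mulmx_suml.
  apply: eq_big => g; first by rewrite groupMr.
  rewrite groupMr // => Sg; have Gg := subsetP sSG _ Sg; have Ga := subsetP sSG _ Sa.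
  rewrite sperm_actM ?groupV ?groupM // invMg mulgA mulgV mul1g.
  by rewrite repr_mxM // !mulmxA.
move=> c; rewrite codiff_sum -[RHS]mulmx1 -tr mulmx_sumr (reindex_inj invg_inj) /=.
apply: eq_big => g; first by rewrite groupV.
rewrite groupV => Sg; rewrite codiff_mulmx (codiff_sperm _ (@p_inj _)) eh invgK ef //.
by rewrite !mulmxA.
Qed.

(** Closedness persists because h D has codifferential f D = 0. At the bottom the cochain is
    constant on vertices, and equivariance makes its value invariant. *)
Lemma tower_exists n i (f : cell B -> 'rV[k]_(d i)) :
    homog n f -> codiff_closed f -> equiv_cochain S f -> (forall c, f c *m D i (i - 1) = 0) ->
  tower S n f (fun j zeta => [/\ j = i - n%:Z, zeta *m D j (j - 1) = 0
    & {in S, forall g, zeta *m rho j g = zeta}]).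
Proof.
elim: n i f => [|n IH] i f hf cf ef fD /=.
  split=> // [|g Sg]; first by rewrite subr0.
  by rewrite -ef // sperm_cell0; apply: closed_const.
have [h [hh eh dh]] := equiv_acyclic hf cf ef.
exists h; split=> //.
rewrite (_ : i - n.+1%:Z = i - 1 - n%:Z); last by rewrite -addrA -opprD -PoszD add1n.
apply: IH.
- by move=> c nc; rewrite hh ?mul0mx.
- by move=> c; rewrite codiff_mulmx dh fD.
- by move=> g c Sg; rewrite eh // -!mulmxA rho_diff // (subsetP sSG).
by move=> c; rewrite -mulmxA diff_diff_pred mulmx0.
Qed.

End Existence.

Variable th : theta_map P.
Variable c : 'cV[k]_(d (-1)).
Hypothesis diff_c : D 0 (-1) *m c = cr_aug P.
Variable r : gT.
Hypothesis Gr : r \in G.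
Hypothesis rr : (r * r = 1)%g.
Hypothesis actrr : forall c : cell B, act r (act r c) = c.

Local Notation evaluates_to n tau :=
  (fun j zeta => zeta *m res_col th c r n j = tau).

(** The equivariant primitive [f] differs from [h] by a closed [u]. This is constant on vertices at
    the bottom; above, u = codiff l, and l (1 + r) is an equivariant primitive of h (1 + r). *)
Lemma tower_restrict n t i (h : cell B -> 'rV[k]_(d i)) tau :
    i < 0 -> homog n h -> (forall x, h x *m D i (i - 1) = 0) ->
    tower [set r] n.+1 (codiff h) (evaluates_to t.+1 tau) ->
  tower [set r] n (fun x => h x + h (act r x) *m rho i r) (evaluates_to t tau).
Proof.
have rhoK j : rho j r *m rho j r = 1%:M by rewrite -repr_mxM // rr repr_mx1.
elim: n i h => [|n IH] i h i0 hh hD [f [hf ef df tf]].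
  pose u x := f x + h x; have cu : codiff_closed u by move=> x; rewrite codiffD df addF2.
  have eh x : h x = f x + u x by rewrite /u addrA addF2 add0r.
  have uo : u (act r origin) = u origin by rewrite sperm_cell0; apply: closed_const.
  have fD : f origin *m D i (i - 1) = u origin *m D i (i - 1).
    by rewrite /u mulmxDl hD addr0.
  move: tf => /= <-; rewrite fD -[RHS]mulmxA diff_res_col //.
  rewrite [u origin *m _]mulmxDr [u origin *m (_ *m _)]mulmxA -mulmxDl.
  congr (_ *m _); rewrite !eh uo ef ?inE // mulmxDl -mulmxA rhoK mulmx1.
  by rewrite addrACA addF2 add0r.
pose u x := f x + h x; have cu : codiff_closed u by move=> x; rewrite codiffD df addF2.
have hu : homog n.+1 u by move=> x nx; rewrite /u hf // hh // addr0.
have [l hl dl] := acyclic hu cu.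
exists (fun x => l x + l (act r x) *m rho i r); split.
- by move=> x nx; rewrite !hl ?cell_deg_sperm // mul0mx addr0.
- move=> g x; rewrite inE => /eqP->.
  by rewrite actrr mulmxDl -mulmxA rhoK mulmx1 addrC.
- move=> x; rewrite codiffD codiff_mulmx (codiff_sperm _ (@p_inj _)) !dl /u.
  by rewrite ef ?inE // mulmxDl -[f x *m _ *m _]mulmxA rhoK mulmx1 addrACA addF2 add0r.
(* Since h D = 0, [l D] is a primitive of [f D], perhaps not equivariant, and the induction applies
   one level lower. *)
have tl : tower [set r] n.+1 (codiff (fun x => l x *m D i (i - 1))) (evaluates_to t.+1 tau).
  apply: (@eq_tower _ n.+1 (i - 1) (fun x => f x *m D i (i - 1))) tf => x.
  by rewrite codiff_mulmx dl /u mulmxDl hD addr0.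
have i10 : i - 1 < 0 by apply: lt_trans i0; rewrite gtrBl.
apply: eq_tower (IH _ _ i10 _ _ tl) => x.
- by rewrite mulmxDl -!mulmxA rho_diff.
- by move=> nx; rewrite hl ?mul0mx.
by rewrite -mulmxA diff_diff_pred mulmx0.
Qed.

(** On the last level [h D] is constant on vertices, so it can be evaluated at the fixed one, where
    [h] is [r]-invariant and 1 + r kills it. *)
Lemma tower_fixed n t i (f : cell B -> 'rV[k]_(d i)) x tau :
    i < 0 -> (forall c, f c *m D i (i - 1) = 0) -> act r (cell0 x) = cell0 x ->
    tower [set r] n.+1 f (evaluates_to t.+1 tau) ->
  tau = 0.
Proof.
elim: n i f => [|n IH] i f i0 fD rx [h [hh eh dh th']].
  move: th' => /= <-.
  have -> : h origin *m D i (i - 1) = h (cell0 x) *m D i (i - 1).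
    apply: (@closed_const _ _ (fun c => h c *m D i (i - 1))) => y.
    by rewrite codiff_mulmx dh fD.
  rewrite -mulmxA diff_res_col // [h _ *m _]mulmxDr [h _ *m (_ *m _)]mulmxA.
  rewrite -eh ?inE // rx.
  exact: addF2.
apply: (IH (i - 1)) th' => //; last by move=> y; rewrite -mulmxA diff_diff_pred mulmx0.
by apply: lt_trans i0; rewrite gtrBl.
Qed.

(** As [r] flips every coordinate, a half-space primitive and its translate add up to the monomial
    with one factor fewer; n descents reach degree 0. *)
Lemma tower_free n (mu : {ffun B -> nat}) (eta : 'rV[k]_(d (-1))) tau :
    (forall b, p r b = b) -> (forall b, s r b) ->
    eta *m rho (-1) r = eta -> eta *m D (-1) (-1 - 1) = 0 ->
    (\sum_b mu b = n)%N ->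
    tower [set r] n (mono_cochain eta mu) (evaluates_to n tau) ->
  tau = eta *m res_col th c r 0 (-1).
Proof.
move=> pr sr er eD; elim: n mu => [|n IH] mu.
  move=> mu0 /=; rewrite /mono_cochain; case: eqP => [_ <- //|[]].
  apply/ffunP=> b; rewrite ffunE /=; apply/esym/eqP.
  by move/eqP: mu0; rewrite sum_nat_eq0 => /forallP/(_ b).
move=> emu tmu; have [b mub] : exists b, (0 < mu b)%N.
  apply/existsP; apply/existsPn => mu0; move: emu; rewrite big1 // => b _.
  by apply/eqP; have := mu0 b; rewrite -eqn0Ngt.
have hdeg := homog_mono_primitive eta mub emu.
have prim0 x : mono_primitive eta b mu x *m D (-1) (-1 - 1) = 0.
  by rewrite /mono_primitive; case: ifP => _; rewrite ?mul0mx.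
have tl := tower_restrict _ hdeg prim0
  (eq_tower (fun x => esym (codiff_mono_primitive eta mub x)) tmu).
apply: (IH (lower b mu)).
  have := cell_deg_lower [ffun=> false] mub; rewrite /cell_deg /= emu => -[<-] //.
apply: eq_tower (tl _) => // -[m x].
rewrite /mono_primitive /mono_cochain /= ffunE pr sr.
rewrite (_ : [ffun b => m (p r b)] = m); last by apply/ffunP=> b'; rewrite ffunE pr.
by case: eqP => _; case: (x b); rewrite /= ?er ?mul0mx ?addr0 ?add0r.
Qed.

End Towers.

(** * The action on the cosets of a central involution *)

Section AntipodalAction.

Variables (gT : finGroupType) (S : {group gT}) (z : gT).
Hypotheses (Zz : z \in 'Z(S)%g) (z1 : z != 1%g) (zz : (z * z = 1)%g).

Let rank (b : gT) : nat := enum_rank b.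

(* Representatives of the cosets of <[z]>: [half_sign g] records where right translation
   by g^-1 leaves them. *)
Definition half_set : {set gT} := [set b in S | rank b < rank (z * b)%g]%N.
Local Notation B := {b : gT | b \in half_set}.

Definition to_half (b : gT) : gT := if b \in half_set then b else (z * b)%g.

Definition half_act (g : gT) (b : B) : B := insubd b (to_half (val b * g^-1)%g).
Definition half_sign (g : gT) (b : B) : bool := (val b * g^-1)%g \notin half_set.

Let Sz : z \in S. Proof. by case/setIP: Zz. Qed.
Let zC b : b \in S -> (z * b = b * z)%g.
Proof. by case/setIP: Zz => _ /centP; apply. Qed.
Let zK b : (z * (z * b) = b)%g. Proof. by rewrite mulgA zz mul1g. Qed.

Lemma rank_inj : injective rank.
Proof. by move=> a b /val_inj/enum_rank_inj. Qed.

Lemma half_mulz b : b \in S -> ((z * b)%g \in half_set) = (b \notin half_set).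
Proof.
move=> Sb; rewrite !inE groupM // Sb zK /= -leqNgt ltn_neqAle.
by rewrite (inj_eq rank_inj) -{2}[b]mul1g (inj_eq (mulIg b)) z1.
Qed.

Lemma halfS b : b \in half_set -> b \in S. Proof. by rewrite inE => /andP[]. Qed.

Lemma to_half_mem b : b \in S -> to_half b \in half_set.
Proof. by rewrite /to_half => Sb; case: ifP => // nb; rewrite half_mulz // nb. Qed.

Lemma to_half_mulz b : b \in S -> to_half (z * b)%g = to_half b.
Proof. by move=> Sb; rewrite /to_half half_mulz // zK; case: (b \in half_set). Qed.

Lemma to_half_mul b g : b \in S -> g \in S -> to_half (to_half b * g)%g = to_half (b * g)%g.
Proof.
move=> Sb Sg; rewrite {2}/to_half; case: ifP => // _.
by rewrite -mulgA to_half_mulz ?groupM.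
Qed.

Lemma val_half_act g b : g \in S -> val (half_act g b) = to_half (val b * g^-1)%g.
Proof.
move=> Sg; rewrite val_insubd to_half_mem // groupM ?groupV //.
exact: halfS (valP b).
Qed.

(** The default of [insubd] makes the action trivial outside [S], giving injectivity for every [g],
    as [p_inj] demands. *)
Lemma half_act_out g b : g \notin S -> half_act g b = b.
Proof.
move=> nSg; rewrite /half_act /insubd insubN //.
have nS : (val b * g^-1)%g \notin S by rewrite groupMl ?groupV // (halfS (valP b)).
have nh : (val b * g^-1)%g \notin half_set by apply: contra nS => /halfS.
rewrite /to_half (negPf nh).
by apply: contra nS => /halfS; rewrite (groupMl _ Sz).
Qed.

Lemma half_act1 b : half_act 1%g b = b.
Proof.
by apply: val_inj; rewrite val_half_act // invg1 mulg1 /to_half (valP b).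
Qed.

Lemma half_sign1 b : half_sign 1%g b = false.
Proof. by rewrite /half_sign invg1 mulg1 (valP b). Qed.

Lemma half_actM : {in S &, forall g h b, half_act h (half_act g b) = half_act (h * g)%g b}.
Proof.
move=> g h Sg Sh b; have Sb := halfS (valP b); apply: val_inj.
by rewrite !val_half_act ?groupM // to_half_mul ?groupM ?groupV // invMg mulgA.
Qed.

Lemma half_signM : {in S &, forall g h b,
  half_sign h (half_act g b) (+) half_sign g b = half_sign (h * g)%g b}.
Proof.
move=> g h Sg Sh b; have Sb := halfS (valP b).
rewrite /half_sign val_half_act // invMg mulgA /to_half.
case: ifP => _ /=; rewrite ?addbF // addbT -mulgA half_mulz ?negbK //.
by rewrite !groupM ?groupV.
Qed.

Lemma half_act_inj g : injective (half_act g).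
Proof.
case: (boolP (g \in S)) => [Sg|nSg].
  apply: (@can_inj _ _ _ (half_act g^-1)) => b.
  by rewrite half_actM ?groupV // mulVg half_act1.
by move=> a b; rewrite !half_act_out.
Qed.

Lemma half_actz b : half_act z b = b.
Proof.
have Sb := halfS (valP b); apply: val_inj; rewrite val_half_act //.
have -> : (z^-1 = z)%g by apply/eqP; rewrite eq_invg_mul zz.
by rewrite -zC // to_half_mulz // /to_half (valP b).
Qed.

Lemma half_signz b : half_sign z b.
Proof.
have Sb := halfS (valP b); rewrite /half_sign.
have -> : (z^-1 = z)%g by apply/eqP; rewrite eq_invg_mul zz.
by rewrite -zC // half_mulz // negbK (valP b).
Qed.

Lemma card_half : #|S| = (2 * #|{: B}|)%N.
Proof.
rewrite card_sig -(cardsID half_set S) mul2n -addnn; congr (_ + _)%N.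
  by apply: eq_card => b; rewrite !inE andbA andbb.
rewrite -(card_imset [in half_set] (mulgI z)); apply: eq_card => b.
apply/setDP/imsetP => [[Sb nb]|[a ah ->]]; last first.
  have Sa := halfS ah; by rewrite half_mulz // groupM // negbK.
have zbh : (z * b)%g \in half_set by rewrite half_mulz.
by exists (z * b)%g; rewrite ?zK.
Qed.

(* Comparing the smallest ranks in b<[r]> and zb<[r]> gives an antipodal choice of
   signs that is constant on the left cosets of <[r]>. *)
Lemma half_fixed r : r \in S -> (r * r = 1)%g -> r != z ->
  exists x, sperm (half_act r) (half_sign r) (cell0 x) = cell0 x.
Proof.
move=> Sr rr nrz; pose f b := minn (rank b) (rank (b * r)%g).
pose chi b := (f b < f (z * b)%g)%N.
have fr b : f (b * r)%g = f b by rewrite /f -mulgA rr mulg1 minnC.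
have chir b : chi (b * r)%g = chi b by rewrite /chi mulgA !fr.
(* The cosets of [b] and [z b] are disjoint because r differs from z, so their smallest ranks cannot
   tie. *)
have chiz b : b \in S -> chi (z * b)%g = ~~ chi b.
  move=> Sb; rewrite /chi zK -leqNgt ltn_neqAle andbC; case: leqP => //= _.
  have zb : (z * b)%g != b by rewrite -{2}[b]mul1g (inj_eq (mulIg b)).
  have zbr : (z * b)%g != (b * r)%g.
    by rewrite zC // (inj_eq (mulgI b)) eq_sym.
  have zbr' : (z * b * r)%g != b.
    by rewrite -(inj_eq (mulIg r)) -mulgA rr mulg1.
  have zbr2 : (z * b * r)%g != (b * r)%g by rewrite (inj_eq (mulIg r)).
  by rewrite /f /minn; do 2!case: ifP => _; rewrite (inj_eq rank_inj).
exists [ffun b => chi (val b)]; congr pair; apply/ffunP => b; rewrite !ffunE //=.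
have Sb := halfS (valP b); rewrite val_half_act // /half_sign.
have -> : (r^-1 = r)%g by apply/eqP; rewrite eq_invg_mul rr.
rewrite /to_half; case: ifP => _ /=; rewrite ?addbF ?chir // addbT.
by rewrite chiz ?groupM // negbK chir.
Qed.

End AntipodalAction.

(** * Non-triviality *)

Section NonTriviality.

Variables (gT : finGroupType) (G : {group gT}) (P : complete_resolution G).
Local Notation k := 'F_2.
Local Notation d := (cr_dim P).
Local Notation D := (cr_diff P).
Local Notation rho := (cr_mod P).
Local Notation eps := (cr_aug P).

Lemma cycle_exists (S : {group gT}) (z : gT) (eta : 'rV[k]_(d (-1))) (n l : nat) :
    S \subset G -> z \in 'Z(S)%g -> z != 1%g -> (z * z = 1)%g ->
    n.+1 = (#|S| * l)%N ->
    {in S, forall g, eta *m rho (-1) g = eta} -> eta *m D (-1) (-1 - 1) = 0 ->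
  exists zeta : 'rV[k]_(d (-1 - n.+1%:Z)),
  [/\ zeta *m D (-1 - n.+1%:Z) (-1 - n.+1%:Z - 1) = 0,
      {in S, forall g, zeta *m rho (-1 - n.+1%:Z) g = zeta}
    & forall (th : theta_map P) c, D 0 (-1) *m c = eps ->
      {in S, forall r, (r * r = 1)%g ->
        zeta *m res_col th c r n.+1 (-1 - n.+1%:Z) =
        if r == z then eta *m res_col th c r 0 (-1) else 0}].
Proof.
move=> sSG Zz z1 zz en ezS eD; have [Sz _] := setIP Zz.
pose B := {b : gT | b \in half_set S z}.
(* As |S| = 2 |B|, the exponent 2l on every factor gives total degree |S| l; constancy makes the
   monomial permutation invariant. *)
pose mu : {ffun B -> nat} := [ffun => l.*2].
have emu : (\sum_b mu b = n.+1)%N.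
  rewrite en (card_half Zz z1 zz) (eq_bigr (fun=> l.*2)) => [|b _]; last by rewrite ffunE.
  by rewrite sum_nat_const -mul2n mulnA [(2 * _)%N]mulnC.
pose y := mono_cochain eta mu.
pose p := @half_act _ S z; pose s := @half_sign _ S z.
have p_inj g : injective (p g) by apply: half_act_inj.
have yS : equiv_cochain p s S y.
  move=> g [m x] Sg; rewrite /y /mono_cochain /=.
  have -> : ([ffun b => m (p g b)] == mu) = (m == mu).
    apply/eqP/eqP => [e|->]; last by apply/ffunP=> b; rewrite !ffunE.
    apply/ffunP=> b; have [q pq qp] := injF_bij (p_inj g).
    by move/ffunP/(_ (q b)): e; rewrite !ffunE qp.
  by case: ifP => _; rewrite ?mul0mx // ezS.
have hy : homog n.+1 y by rewrite -emu; apply: homog_mono_cochain.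
have cy : codiff_closed y by apply: closed_mono_cochain.
have yD c : y c *m D (-1) (-1 - 1) = 0.
  by rewrite /y /mono_cochain; case: ifP => _; rewrite ?mul0mx.
have := tower_exists p_inj sSG
  (half_actM Zz z1 zz) (half_signM Zz z1 zz) hy cy yS yD.
case/tower_end=> j [zeta [[ej zD zS] tz]]; subst j.
exists zeta; split=> // th c dc r Sr rr; have Gr := subsetP sSG _ Sr.
have actrr x : sperm (p r) (s r) (sperm (p r) (s r) x) = x.
  rewrite (sperm_actM (half_actM Zz z1 zz) (half_signM Zz z1 zz)) // rr.
  exact: (sperm_act1 (half_act1 Zz z1 zz) (@half_sign1 _ S z)).
have tr := tz [set r] (fun j x => x *m res_col th c r n.+1 j =
  zeta *m res_col th c r n.+1 (-1 - n.+1%:Z)).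
have subr : [set r] \subset S by rewrite sub1set.
have {tr} tr := tr subr (erefl _).
case: (r =P z) => [erz|/eqP nrz].
  apply: (tower_free p_inj dc Gr rr actrr _ _ _ _ emu tr) => //.
  - by move=> b; rewrite erz; apply: half_actz.
  - by move=> b; rewrite erz; apply: half_signz.
  exact: ezS.
have [x fx] := half_fixed Zz z1 zz Sr rr nrz.
exact: (tower_fixed dc Gr rr _ yD fx tr).
Qed.

(** Terms of r and r^-1 cancel in characteristic 2; the enumeration rank picks one of each pair. *)
Lemma sum_inv_symm (S : {group gT}) (V : lmodType k) (F : gT -> V) :
    {in S, forall r, F r = F r^-1%g} ->
  \sum_(r in S) F r = \sum_(r in S | (r * r == 1)%g) F r.
Proof.
move=> Fsymm; pose rank (b : gT) : nat := enum_rank b.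
have rank_inj : injective rank by move=> a b /val_inj/enum_rank_inj.
rewrite (bigID (fun r => r * r == 1)%g) /= -[RHS]addr0; congr (_ + _).
rewrite (bigID (fun r => rank r < rank r^-1%g)%N) /=.
set X := \sum_(r | _) _; suff -> : \sum_(i | (i \in S) && (i * i != 1)%g &&
    ~~ (rank i < rank i^-1%g)%N) F i = X by exact: addF2.
rewrite (reindex_inj invg_inj) /X; apply: eq_big => r /=; last first.
  by rewrite groupV => /andP[/andP[Sr _] _]; rewrite -Fsymm.
rewrite groupV invgK -invMg invg_eq1 -leqNgt leq_eqVlt (inj_eq rank_inj).
by rewrite -eq_invg_mul; case: eqVneq; rewrite ?andbF.
Qed.

(** D_0 kills ker eps, so it factors through eps. Were omega D_0 zero, exactness would make D_1 onto
    and eps zero; [c] reads off a nonzero entry of it, which is 1. *)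
Lemma aug_factor : exists omega : 'rV[k]_(d 0), [/\ omega *m eps = 1%:M,
  {in G, forall g, omega *m D 0 (-1) *m rho (-1) g = omega *m D 0 (-1)}
  & exists c, D 0 (-1) *m c = eps].
Proof.
have [omega omega1] := row_fullP (cr_aug_onto P).
have D0 : D 0 (-1) = eps *m (omega *m D 0 (-1)).
  apply/eqP; rewrite mulmxA -subr_eq0 -{1}[D 0 (-1)]mul1mx -mulmxBl.
  have : (1%:M - eps *m omega <= D 1 0)%MS.
    have /andP[_ sub] := cr_aug_ker P; apply: submx_trans sub.
    by apply/sub_kermxP; rewrite mulmxBl mul1mx -mulmxA omega1 mulmx1 subrr.
  by case/submxP => X ->; rewrite -mulmxA (diff_diff P 0) mulmx0.
exists omega; split=> // [g Gg|].
  by rewrite -mulmxA -rho_diff // D0 [rho 0 g *m _]mulmxA rho_aug.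
have [j ej] : exists j, (omega *m D 0 (-1)) 0 j != 0.
  apply/existsP; apply: contraT => /existsPn e0.
  have D00 : D 0 (-1) = 0.
    rewrite D0 (_ : omega *m _ = 0) ?mulmx0 //; apply/rowP=> j.
    by rewrite [RHS]mxE; apply/eqP; rewrite -[_ == _]negbK e0.
  have : (1%:M <= D 1 0)%MS.
    have /andP[_ sub] := cr_exact P 0; apply: submx_trans sub.
    by apply/sub_kermxP; rewrite mul1mx.
  case/submxP=> X /(congr1 (mulmx^~ eps)); rewrite mul1mx -mulmxA diff_aug mulmx0.
  by move=> eps0; move/eqP: omega1; rewrite eps0 mulmx0 eq_sym oner_eq0.
exists (delta_mx j 0); rewrite D0 -mulmxA -colE -[RHS]mulmx1; congr (_ *m _).
apply/matrixP=> a b; rewrite [LHS]mxE [RHS]mxE !ord1 /=.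
by case: ((omega *m _) 0 j) ej => [[|[|]]] //= *; apply/val_inj.
Qed.

Lemma ev2_sum_pair f i s t (I : finType) (Q Q' : pred I) (u : I -> 'cV_(d s)) (v : I -> 'cV_(d t)) :
  ev2 f i (\sum_(a | Q a) u a) (\sum_(b | Q' b) v b) =
  \sum_(a | Q a) \sum_(b | Q' b) ev2 f i (u a) (v b).
Proof.
rewrite (big_morph (fun w => ev2 f i w _) (fun _ _ => ev2Dl _ _ _ _ _) (ev2_0l _ _ _ _)).
apply: eq_bigr => a _.
by rewrite (big_morph (fun w => ev2 f i _ w) (fun _ _ => ev2Dr _ _ _ _ _) (ev2_0r _ _ _ _)).
Qed.

(** Substitute g r for the second summation variable and move g onto [w] by equivariance. *)
Lemma ev2_trace (th : theta_map P) (S : {group gT}) l i (c : 'cV[k]_(d (-1))) (w : 'rV[k]_(d i)) :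
    S \subset G ->
  w *m ev2 (theta th l W_gen) i (\sum_(g in S) rho (-1) g *m c) (\sum_(g in S) rho (-1) g *m c) =
  \sum_(r in S) (\sum_(g in S) w *m rho i g) *m
    ev2 (theta th l W_gen) i c (rho (-1) r *m c).
Proof.
move=> sSG; rewrite ev2_sum_pair mulmx_sumr.
under [RHS]eq_bigr do rewrite mulmx_suml.
rewrite [RHS]exchange_big /=; apply: eq_bigr => g Sg; rewrite mulmx_sumr.
rewrite (reindex_inj (mulgI g)) /=; apply: eq_big => r; first exact: groupMl.
rewrite (groupMl _ Sg) => Sr; have Gg := subsetP sSG _ Sg; have Gr := subsetP sSG _ Sr.
rewrite (repr_mxM _ Gg Gr) -[_ *m _ *m c]mulmxA -(ev2_act _ _ _ (theta_hom2 th l) Gg).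
exact: mulmxA.
Qed.

(** An invariant form on P_i is the S-trace of phi b, so its value at [v] depends only on the
    S-trace of [v]. *)
Lemma trace_eq0 (S : {group gT}) i (v : 'rV[k]_(d i)) (b : 'cV[k]_(d i)) :
    S \subset G -> coch b -> \sum_(g in S) v *m rho i g = 0 -> v *m b = 0.
Proof.
move=> sSG hb v0; have [phi tr] := projective_relative_trace sSG (@cr_projective _ _ P i).
rewrite -[v]mulmx1 -tr mulmx_sumr mulmx_suml -[RHS](mul0mx _ (phi *m b)) -v0 mulmx_suml.
apply: eq_bigr => g Sg; have Gg := subsetP sSG _ Sg.
rewrite -!mulmxA; congr (_ *m (_ *m (_ *m _))).
by rewrite (kG_homE hb) ?groupV //= mulmx1.
Qed.

Lemma inv_trace (S : {group gT}) i (zeta : 'rV[k]_(d i)) : S \subset G ->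
    {in S, forall g, zeta *m rho i g = zeta} ->
  exists w, \sum_(g in S) w *m rho i g = zeta.
Proof.
move=> sSG zS; have [phi tr] := projective_relative_trace sSG (@cr_projective _ _ P i).
exists (zeta *m phi); rewrite -[RHS]mulmx1 -tr mulmx_sumr (reindex_inj invg_inj) /=.
apply: eq_big => g; first by rewrite groupV.
by rewrite groupV => Sg; rewrite mulmxA [zeta *m (_ *m phi)]mulmxA zS.
Qed.

Lemma coch_trace i (c : 'cV[k]_(d i)) : coch (\sum_(g in G) rho i g *m c).
Proof.
apply/forall_inP=> h Gh; rewrite /= mulmx1 mulmx_sumr; apply/eqP.
rewrite [RHS](reindex_inj (mulgI h)) /=; apply: eq_big => g; first by rewrite groupMl.
by move=> Gg; rewrite mulmxA repr_mxM.
Qed.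

End NonTriviality.

(** * Evaluation over a Sylow 2-subgroup *)

Local Open Scope quotient_scope.

Lemma tate_class_neq0 (gT : finGroupType) (G : {group gT}) (P : complete_resolution G)
    n (a : cocycle P n) : ~~ is_coboundary a -> tate_class a != 0.
Proof.
apply: contra => /eqP a0.
have : \pi_(tate P n) a = \pi_(tate P n) 0 by rewrite -/(tate_class a) a0 raddf0.
by move/eqmodP; rewrite /= /Quotient.equiv subr0.
Qed.

Lemma mulrn_F2 (V : lmodType 'F_2) (v : V) m : v *+ m = v *+ odd m.
Proof.
by rewrite -[m in LHS]odd_double_half -muln2 mulrnDr mulnC mulrnA mulr2n addF2 mul0rn addr0.
Qed.

Lemma sum_ev2_eq1 (gT : finGroupType) (G S : {group gT}) (P : complete_resolution G)
    (th : theta_map P) c (z : gT) n i (zeta : 'rV_(cr_dim P i)) :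
    cr_diff P 0 (-1) *m c = cr_aug P -> S \subset G -> z \in S -> (z * z = 1)%g ->
    odd #|S| = false -> i < 0 -> zeta *m cr_diff P i (i - 1) = 0 ->
    {in S, forall g, zeta *m cr_mod P i g = zeta} ->
    {in S, forall r, (r * r = 1)%g ->
      zeta *m res_col th c r n.+1 i = if r == z then 1%:M else 0} ->
  \sum_(r in S) zeta *m ev2 (theta th n W_gen) i c (cr_mod P (-1) r *m c) = 1%:M.
Proof.
move=> Dc sSG Sz zz evenS i0 zD zS zres.
(* The extra term of [res_col], pairing eps with c, is independent of [r], and its |S| copies cancel
   as |S| is even. *)
have -> : \sum_(r in S) zeta *m ev2 (theta th n W_gen) i c (cr_mod P (-1) r *m c) =
    \sum_(r in S) zeta *m res_col th c r n.+1 i.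
  under [RHS]eq_bigr do rewrite mul_res_colS.
  by rewrite big_split /= sumr_const mulrn_F2 evenS add0r.
rewrite sum_inv_symm => [|r Sr]; last first.
  have symm := ev2_inv_symm th Dc n (subsetP sSG _ Sr) i0 zD (zS _ Sr).
  have e x := mul_res_colS th c x n zeta.
  apply: etrans (e r) _; apply: etrans (esym (e r^-1%g)).
  exact: (congr1 (fun x => _ + x) symm).
rewrite (bigD1 z) /=; last by rewrite Sz zz eqxx.
rewrite big1 => [|r /andP[/andP[Sr /eqP rr] /negPf nrz]].
  by rewrite zres // eqxx addr0.
by rewrite zres // nrz.
Qed.

(* With S a Sylow 2-subgroup, the generator of degree -1 is the trace over G of a linear
   form c0 with c0 o D = eps, hence the trace over S of the sum c of the translates of c0
   under the oddly many cosets of S. *)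
Lemma tate_Q_neq0 (gT : finGroupType) (G S : {group gT}) (P : complete_resolution G)
    (th : theta_map P) (z : gT) (n l : nat) :
    S \subset G -> odd #|G : S|%g -> z \in 'Z(S)%g -> z != 1%g -> (z * z = 1)%g ->
    n.+1 = (#|S| * l)%N ->
  exists x : tate P (-1), tate_Q th n.+1%:Z x != 0.
Proof.
move=> sSG oddGS Zz z1 zz en; have [Sz _] := setIP Zz.
have [T sTG sumT] := transversal_sum sSG.
have [omega [omega1 etaG [c0 Dc0]]] := aug_factor P.
pose eta := omega *m cr_diff P 0 (-1).
have etaD : eta *m cr_diff P (-1) (-1 - 1) = 0.
  by rewrite -mulmxA (diff_diff P (-1)) mulmx0.
pose c := \sum_(t in T) cr_mod P (-1) t *m c0.
pose a := \sum_(g in G) cr_mod P (-1) g *m c0.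
have aE : a = \sum_(g in S) cr_mod P (-1) g *m c.
  rewrite /a sumT exchange_big /=; apply: eq_bigr => g Sg; rewrite mulmx_sumr.
  apply: eq_bigr => t Tt; by rewrite mulmxA (repr_mxM _ (subsetP sSG _ Sg) (subsetP sTG _ Tt)).
have oddT : odd #|T|.
  have := sumT nat (fun=> 1%N); rewrite sumr_const.
  under eq_bigr do rewrite sumr_const.
  rewrite sumr_const natn -mulrnA natn -(Lagrange sSG) => /eqP.
  by rewrite eqn_pmul2l ?cardG_gt0 // => /eqP <-.
have evenS : odd #|S| = false.
  have := order_dvdG Sz.
  have -> : #[z]%g = 2%N by apply: nt_prime_order.
  by rewrite dvdn2 => /negPf.
have evenG : odd #|G| = false by rewrite -(Lagrange sSG) oddM evenS.
have Dc : cr_diff P 0 (-1) *m c = cr_aug P.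
  rewrite mulmx_sumr (eq_bigr (fun=> cr_aug P)) => [|x Tx].
    by rewrite sumr_const mulrn_F2 oddT.
  by rewrite mulmxA -rho_diff ?(subsetP sTG) // -mulmxA Dc0 rho_aug ?(subsetP sTG).
have cocycle_a : is_cocycle a.
  apply/andP; split; first exact: coch_trace.
  rewrite (_ : cr_diff P (-1 + 1) (-1) *m a = 0) //.
  rewrite mulmx_sumr (eq_bigr (fun=> cr_aug P)) => [|g Gg].
    by rewrite sumr_const mulrn_F2 evenG.
  by rewrite mulmxA -rho_diff // -mulmxA Dc0 rho_aug.
exists (tate_class (Cocycle cocycle_a)).
(* Degree -1 lowers the index by one: the value of Q_(n+1) is computed from e_n. *)
rewrite tate_Q_class (_ : n.+1%:Z + -1 = n%:Z); last first.
  by rewrite -addn1 PoszD addrK.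
apply: tate_class_neq0; apply/existsP => -[b /andP[cb /eqP]] /=.
set i := -1 - n.+1%:Z => qb.
have i0 : i < 0 by rewrite /i -opprD oppr_lt0.
have etaS : {in S, forall g, eta *m cr_mod P (-1) g = eta}.
  by move=> g Sg; apply: etaG; apply: (subsetP sSG).
have [zeta [zD zS zres]] := cycle_exists sSG Zz z1 zz en etaS etaD.
have [w wz] := inv_trace sSG zS.
(* A coboundary pairs to zero with [w], since w D has S-trace zeta D = 0. *)
have w0 : w *m ev2 (theta th n W_gen) i a a = 0.
  rewrite qb mulmxA; apply: (trace_eq0 sSG cb).
  rewrite (eq_bigr (fun g => w *m cr_mod P i g *m cr_diff P i (i - 1))) => [|g Sg].
    by rewrite -mulmx_suml wz zD.
  by rewrite -!mulmxA rho_diff // (subsetP sSG).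
suff : w *m ev2 (theta th n W_gen) i a a = 1%:M.
  by rewrite w0 => /matrixP/(_ 0 0); rewrite !mxE => /eqP; rewrite eq_sym oner_eq0.
rewrite aE ev2_trace // wz.
apply: (sum_ev2_eq1 Dc sSG Sz zz evenS i0 zD zS) => r Sr rr.
by rewrite zres // /eta -mulmxA diff_res_col0 // omega1.
Qed.

Unset Implicit Arguments.

Theorem corollary5p3 (gT : finGroupType) (G : {group gT})
    (P : complete_resolution G) (th : theta_map P) (i m n : nat)
    (hi : (1 <= i)%N) (hm : odd m) (hG : #|G| = (m * 2 ^ i)%N)
    (hn : (1 <= n)%N) (hdvd : (2 ^ i %| n)%N) :
  exists x : tate P (-1), tate_Q th n%:Z x != 0 :> tate P (-1 - n%:Z).
Proof.
have [S sylS] := Sylow_exists 2 G.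
have m0 : (0 < m)%N by case: m hm {hG}.
have cS : #|S| = (2 ^ i)%N.
  by rewrite (card_Hall sylS) hG p_part lognM ?expn_gt0 // pfactorK // logn_coprime //
    coprime2n.
have sSG := pHall_sub sylS.
have oddGS : odd #|G : S|%g.
  have := Lagrange sSG; rewrite cS hG mulnC => /eqP.
  by rewrite eqn_pmul2r ?expn_gt0 // => /eqP->.
have nZ : 'Z(S)%g != 1%g.
  apply/eqP => /(trivg_center_pgroup (pHall_pgroup sylS)) S1.
  by have := @ltn_exp2l 2 0 i isT; rewrite hi -cS S1 cards1.
have [] := pgroup_pdiv (pgroupS (center_sub S) (pHall_pgroup sylS)) nZ.
move=> _ /(Cauchy (isT : prime 2))[z Zz oz] _.
have z1 : z != 1%g by rewrite -order_gt1 oz.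
have zz : (z * z = 1)%g by rewrite -expg2 -oz expg_order.
have [l nl] := dvdnP hdvd; case: n hn hdvd nl => // n _ _ nl.
by apply: (tate_Q_neq0 th sSG oddGS Zz z1 zz (l := l)); rewrite cS mulnC.
Qed.
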